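(* For each $0<\alpha<1$ and each integer $d\ge 2$, the subset $\mathsf{T}_d\setminus \mathcal{E}_{\alpha,d}$ is of the first Baire category.
   Context: Write $\mathbf{e}(x)=\exp(2\pi i x)$. $\mathsf{T}_d=(\mathbb{R}/\mathbb{Z})^d$ is the $d$-dimensional unit torus, identified with the half-open cube $[0,1)^d$. For $\mathbf{x}=(x_1,\dots,x_d)\in\mathsf{T}_d$ and $N\in\mathbb{N}$, define the Weyl sum $$S_d(\mathbf{x};N)=\sum_{n=1}^{N}\mathbf{e}(x_1n+\dots+x_dn^d).$$ For $0<\alpha<1$ define $$\mathcal{E}_{\alpha,d}=\{\mathbf{x}\in\mathsf{T}_d:\ |S_d(\mathbf{x};N)|\ge N^{\alpha}\text{ for infinitely many }N\in\mathbb{N}\}.$$ A subset of $\mathbb{R}^d$ is nowhere dense if its closure in $\mathbb{R}^d$ has empty interior, and is of the first Baire category if it is a countable union of nowhere dense sets. *)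

(* Defs.v *)
From mathcomp Require Import all_boot all_order all_algebra.
From mathcomp Require Import all_classical all_reals all_analysis.
From mathcomp Require Import complex.

Set Implicit Arguments.
Unset Strict Implicit.
Unset Printing Implicit Defensive.

Import Order.TTheory GRing.Theory Num.Theory.
Import numFieldNormedType.Exports.

Local Open Scope classical_set_scope.
Local Open Scope ring_scope.
Local Open Scope complex_scope.

Definition nowhere_dense (T : topologicalType) (A : set T) : Prop :=
  interior (closure A) = set0.

(* Finite unions are covered as well, since [set0] is nowhere dense. *)
Definition first_category (T : topologicalType) (A : set T) : Prop :=
  exists F : nat -> set T,
    (forall k, nowhere_dense (F k)) /\ A = \bigcup_k F k.

(* exp (a + i b) = exp a * (cos b + i sin b) *)
Definition cexp (R : realType) (z : R[i]) : R[i] :=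
  (expR (complex.Re z))%:C * (cos (complex.Im z) +i* sin (complex.Im z)).

Definition e2pi (R : realType) (t : R) : R[i] :=
  cexp (0 +i* (2 * pi * t)).

(* The torus is represented by the half-open cube [0, 1)^d inside R^d, so that
   topological notions refer to the ambient space R^d. *)
Definition torus (R : realType) (d : nat) : set 'rV[R]_d :=
  [set x | forall j : 'I_d, 0 <= x ord0 j < 1].
Arguments torus R d : clear implicits.

(* Coordinates are indexed from 0, so [x ord0 j] is the coefficient of
   n ^ (j + 1). *)
Definition weyl_sum (R : realType) (d : nat) (x : 'rV[R]_d) (N : nat) : R[i] :=
  \sum_(1 <= n < N.+1) e2pi (\sum_(j < d) x ord0 j * n%:R ^+ j.+1).

(* [<=] is the order of R[i]; both sides are real. *)
Definition large_weyl_set (R : realType) (alpha : R) (d : nat) :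
    set 'rV[R]_d :=
  [set x | torus R d x /\
    infinite_set [set N : nat | (0 < N)%N /\
      (N%:R `^ alpha)%:C <= `|weyl_sum x N|]].
Arguments large_weyl_set {R} alpha d.

(* Main.v *)
Require Import Defs.
From mathcomp Require Import all_boot all_order all_algebra.
From mathcomp Require Import all_classical all_reals all_analysis.
From mathcomp Require Import complex.
From mathcomp Require Import ring lra zify.

(** The points of the torus outside the large-sum set are covered by the sets
    of x with |S(x; N)| < N^alpha for all N > k, one for each k.  As
    x |-> |S(x; N)| is continuous, the closure of such a set still satisfies
    |S(x; N)| <= N^alpha for every N > k, so it has empty interior as soon as
    every ball contains a point y with |S(y; N)| > N^alpha for some N > k
    ([large_weyl_sum_dense]).

    Such points are rational.  If y = a / q with a an integer vector, then
    n |-> e(y_1 n + ... + y_d n^d) is q-periodic, so S(y; q M) = M S(y; q)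
    ([sum_periodic]).  When the complete sum S(y; q) is nonzero this grows
    linearly in N = q M and beats N^alpha because alpha < 1 ([powR_gap]).

    It remains to have a dense family of rational points with nonvanishing
    complete sum.  Take q = 3^k and a_j = 3 b_j, except a_2 = 3 b_2 + 1, with
    b an arbitrary integer vector.  The phase is then f(n) / q with
    f = X^2 + 3 g, g an integer polynomial, and squaring out gives
      |S(y; q)|^2 = sum over h, n mod q of e((f(n + h) - f(n)) / q).
    Here f(n + h) - f(n) = h (2 n + h + 3 u(n)) for an integer polynomial u
    depending on h, and n |-> 2 n + h + 3 u(n) permutes the residues modulo
    3^k since its difference quotients are congruent to 2 modulo 3.  The inner
    sum over n is thus a sum of e(h m / q) over all residues m: it vanishes
    unless h = 0, and |S(y; q)|^2 = q ([gauss_sum_3power]).  Every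
    real vector is within 3 / 3^k of such a point ([rational_approx]). *)

Set Implicit Arguments.
Unset Strict Implicit.
Unset Printing Implicit Defensive.
Import Order.TTheory GRing.Theory Num.Theory.
Import numFieldNormedType.Exports.
Local Open Scope classical_set_scope.
Local Open Scope ring_scope.

(** * Sums over residues and integer polynomials *)

(** A map that is injective modulo q permutes the residues modulo q, so it can be
    used as a change of variable in the sum of a q-periodic function. *)
Lemma sum_complete_residues (V : nmodType) (q : nat) (F : int -> V)
    (u : int -> int) :
  (0 < q)%N ->
  (forall m n, (q %| m - n)%Z -> F m = F n) ->
  (forall m n, (q %| u m - u n)%Z -> (q %| m - n)%Z) ->
  \sum_(i < q) F (u i) = \sum_(i < q) F i.
Proof.
move=> q_gt0 Fper u_inj.
have q_neq0 : q%:Z != 0 by lia.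
have res_lt m : (`|(m %% q)%Z| < q)%N.
  by rewrite -ltz_nat gez0_abs ?modz_ge0// ltz_pmod.
have resE m : (q %| m - `|(m %% q)%Z|%N%:Z)%Z.
  by rewrite gez0_abs ?modz_ge0// -eqz_mod_dvd modz_mod.
pose s (i : 'I_q) : 'I_q := Ordinal (res_lt (u i)).
have s_inj : injective s.
  move=> i j /(congr1 val) /= sij; apply: val_inj => /=.
  have /u_inj : (q %| u i - u j)%Z.
    have -> : u i - u j = (u i - `|(u i %% q)%Z|%N%:Z) -
        (u j - `|(u j %% q)%Z|%N%:Z).
      by rewrite sij; ring.
    by rewrite rpredB.
  rewrite -eqz_mod_dvd !modz_nat !modn_small ?ltn_ord// => /eqP; lia.
(* s sends i to the residue of u i in [0, q). *)
rewrite [RHS](reindex_inj s_inj); apply: eq_bigr => i _.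
exact: Fper.
Qed.

(** The divisibility of p(x + h) - p(x) by h with a cofactor that is polynomial
    in x: it is the tail of the Taylor expansion of p at x. *)
Lemma horner_diff (R : comNzRingType) (p : {poly R}) (h : R) :
  exists u : {poly R}, forall x, p.[x + h] - p.[x] = h * u.[x].
Proof.
exists (\sum_(i < (size p).-1) (h ^+ i) *: p^`N(i.+1)) => x.
rewrite nderiv_taylor; last exact: mulrC.
case: (ltnP 0 (size p)) => [/prednK <-|].
  rewrite big_ord_recl /= nderivn0 expr0 mulr1 addrC addKr horner_sum mulr_sumr.
  by apply: eq_bigr => i _; rewrite hornerZ exprS; ring.
rewrite leqn0 size_poly_eq0 => /eqP ->.
by rewrite size_poly0 !big_ord0 !horner0 subr0 mulr0.
Qed.

Lemma dvdz_horner_sub (p : {poly int}) (m n : int) :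
  (m - n %| p.[m] - p.[n])%Z.
Proof.
have [u uE] := horner_diff p (m - n).
by have := uE n; rewrite [n + _]addrC subrK => ->; rewrite dvdz_mulr.
Qed.

(** The difference is (m - n) (2 + 3 w) for some integer w, and 2 + 3 w is a unit
    modulo 3^k. *)
Lemma dvdz_affine_inj (k : nat) (c : int) (u : {poly int}) (m n : int) :
  ((3 ^ k)%N %| (2 * m + c + 3 * u.[m]) - (2 * n + c + 3 * u.[n]))%Z ->
  ((3 ^ k)%N %| m - n)%Z.
Proof.
have /dvdzP[w uw] := dvdz_horner_sub u m n.
have -> : (2 * m + c + 3 * u.[m]) - (2 * n + c + 3 * u.[n])
    = (2 + 3 * w) * (m - n).
  by rewrite [RHS]mulrDl -[3 * w * _]mulrA -uw; ring.
rewrite Gauss_dvdzr// coprimezE /= coprimeXl//.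
by rewrite prime_coprime//; apply/negP => /dvdnP[j]; lia.
Qed.

Lemma sum_root_of_unity (F : fieldType) (z : F) (q : nat) :
  z ^+ q = 1 -> z != 1 -> \sum_(i < q) z ^+ i = 0.
Proof.
move=> zq z1; apply/eqP; have := subrX1 z q; rewrite zq subrr => /esym/eqP.
by rewrite mulf_eq0 subr_eq0 (negbTE z1).
Qed.

(** * The character e(t) *)

Lemma e2piE (R : realType) (t : R) :
  e2pi t = Complex (cos (2 * pi * t)) (sin (2 * pi * t)).
Proof. by rewrite /e2pi /cexp /= expR0 mul1r. Qed.

Lemma e2piD (R : realType) (s t : R) : e2pi (s + t) = e2pi s * e2pi t.
Proof.
rewrite !e2piE mulrDr cosD sinD; apply/eqP.
by rewrite eq_complex /= eqxx/= addrC eqxx.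
Qed.

Lemma e2pi0 (R : realType) : e2pi (0 : R) = 1.
Proof. by rewrite e2piE mulr0 cos0 sin0. Qed.

Lemma e2pi_conj (R : realType) (t : R) : conjc (e2pi t) = e2pi (- t).
Proof. by rewrite !e2piE mulrN cosN sinN. Qed.

Lemma e2piMn (R : realType) (t : R) (n : nat) : e2pi (t * n%:R) = e2pi t ^+ n.
Proof.
elim: n => [|n IHn]; first by rewrite mulr0 e2pi0.
by rewrite mulrS mulrDr mulr1 e2piD IHn exprS.
Qed.

Lemma e2pi_int (R : realType) (m : int) : e2pi (m%:~R : R) = 1.
Proof.
have e1 : e2pi (1 : R) = 1.
  by rewrite e2piE mulr1 mulrC mulr_natr cos2pi sin2pi.
have enat (n : nat) : e2pi (n%:R : R) = 1.
  by rewrite -[n%:R]mul1r e2piMn e1 expr1n.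
case: m => n; first exact: enat.
have := e2piD n.+1%:R (- n.+1%:R : R).
by rewrite subrr e2pi0 enat mul1r NegzE mulrNz => <-.
Qed.

(** By the double angle formula e(t) = 1 forces sin (pi t) = 0, whereas pi t lies
    strictly between 0 and pi. *)
Lemma e2pi_neq1 (R : realType) (t : R) : 0 < t < 1 -> e2pi t != 1.
Proof.
move=> /andP[t0 t1]; rewrite e2piE eq_complex /= negb_and; apply/orP; left.
have -> : 2 * pi * t = (pi * t) *+ 2 by rewrite mulr2n; ring.
have s0 : 0 < sin (pi * t).
  have p0 := pi_gt0 R; apply: sin_gt0_pi; rewrite mulr_gt0//=.
  by rewrite gtr_pMr.
by rewrite cos_mulr2n cos2sin2; apply/eqP; nra.
Qed.

Lemma e2pi_frac_periodic (R : realType) (q : nat) (m n : int) :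
  (0 < q)%N -> (q %| m - n)%Z ->
  e2pi (m%:~R / q%:R : R) = e2pi (n%:~R / q%:R).
Proof.
move=> q_gt0 /dvdzP[j jE]; have -> : m = n + j * q by rewrite -jE; ring.
rewrite intrD intrM mulrDl mulfK ?pnatr_eq0 -?lt0n//.
by rewrite e2piD e2pi_int mulr1.
Qed.

(** Orthogonality of the additive characters modulo q. *)
Lemma sum_e2pi_frac (R : realType) (q h : nat) :
  (h < q)%N -> \sum_(i < q) e2pi ((h%:Z * i%:Z)%:~R / q%:R : R)
               = (q * (h == 0))%:R.
Proof.
move=> hq; have q0 : (q%:R : R) != 0 by rewrite pnatr_eq0; lia.
have pw (i : 'I_q) : e2pi ((h%:Z * i%:Z)%:~R / q%:R : R) = e2pi (h%:R / q%:R) ^+ i.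
  by rewrite -e2piMn intrM; congr e2pi; ring.
rewrite (eq_bigr _ (fun i _ => pw i)); have [->|h0] := eqVneq h 0%N.
  rewrite mul0r e2pi0 (eq_bigr (fun=> 1)) => [|i _]; last by rewrite expr1n.
  by rewrite sumr_const card_ord muln1.
rewrite muln0; apply: sum_root_of_unity.
  by rewrite -e2piMn divfK// -[h%:R]/(h%:~R) e2pi_int.
apply: e2pi_neq1; rewrite divr_gt0 ?ltr0n ?lt0n//=; last by lia.
by rewrite ltr_pdivrMr ?mul1r ?ltr_nat// ltr0n; lia.
Qed.

(** * Complete sums modulo powers of 3 *)

(** Weyl differencing is exact here: for h nonzero modulo q the increment
    f(n + h) - f(n) equals h times a permutation of the residues modulo q, so
    only the diagonal h = 0 of the squared sum survives. *)
Lemma gauss_sum_3power (R : realType) (k : nat) (g : {poly int}) :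
  let q := (3 ^ k)%N in
  let S : R[i] :=
    \sum_(n < q) e2pi (('X^2 + 3 *: g).[n%:Z]%:~R / q%:R) in
  S * conjc S = q%:R.
Proof.
move=> q; set f := 'X^2 + _; set S := \sum_(_ < _) _ => /=.
have q_gt0 : (0 < q)%N by rewrite expn_gt0.
pose psi (m : int) : R[i] := e2pi (m%:~R / q%:R).
have psiP m n : (q %| m - n)%Z -> psi m = psi n by exact: e2pi_frac_periodic.
have psiB m n : psi m * conjc (psi n) = psi (m - n).
  by rewrite /psi e2pi_conj -e2piD intrB mulrBl.
have -> : S * conjc S = \sum_(n < q) \sum_(h < q) psi (f.[n%:Z + h%:Z] - f.[n%:Z]).
  rewrite rmorph_sum mulr_sumr; apply: eq_bigr => n _.
  rewrite mulr_suml (eq_bigr (fun h : 'I_q => psi (f.[h%:Z] - f.[n%:Z])));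
    last first.
    by move=> h _; exact: psiB.
  (* For fixed n, translation by n turns the other variable into n + h. *)
  symmetry; apply: (@sum_complete_residues _ q (fun h => psi (f.[h] - f.[n%:Z]))
                       (fun h => n%:Z + h)) => //.
    move=> a b ab; apply: psiP; rewrite opprB addrA subrK.
    exact: dvdz_trans ab (dvdz_horner_sub f a b).
  by move=> a b; rewrite opprD addrACA subrr add0r.
(* Sum over n first and isolate the diagonal h = 0, which contributes q. *)
rewrite exchange_big /= (bigD1 (Ordinal q_gt0)) //=.
rewrite [X in _ + X]big1 ?addr0 => [|h h0].
  rewrite (eq_bigr (fun=> 1)); first by rewrite sumr_const card_ord.
  by move=> n _; rewrite addr0 subrr /psi mul0r e2pi0.
have [u uE] := horner_diff g h.
have fE (n : int) : f.[n + h%:Z] - f.[n] = h%:Z * (2 * n + h%:Z + 3 * u.[n]).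
  have /eqP := uE n; rewrite subr_eq => /eqP gE.
  by rewrite /f !hornerE gE; ring.
under eq_bigr do rewrite fE.
rewrite (@sum_complete_residues _ q (fun m => psi (h%:Z * m))
                       (fun n => 2 * n + h%:Z + 3 * u.[n])) //.
- have hN0 : (h : nat) != 0%N := h0.
  by rewrite /psi sum_e2pi_frac// (negbTE hN0) muln0.
- by move=> m n mn; apply: psiP; rewrite -mulrBr dvdz_mull.
- by move=> m n; exact: dvdz_affine_inj.
Qed.

Lemma sum_periodic (V : nmodType) (q M : nat) (F : int -> V) :
  (0 < q)%N -> (forall m n, (q %| m - n)%Z -> F m = F n) ->
  \sum_(1 <= n < (q * M).+1) F n%:Z = (\sum_(n < q) F n%:Z) *+ M.
Proof.
move=> q_gt0 Fper; rewrite big_add1 /= big_mkord.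
transitivity (\sum_(i < q * M) F i.+1%:Z); first by [].
rewrite -(big_mkord xpredT (fun i => F i.+1%:Z)).
elim: M => [|M IHM]; first by rewrite muln0 big_geq.
rewrite mulnS addnC (big_cat_nat _ (n := (q * M)%N))//= ?leq_addr// IHM mulrSr.
congr (_ + _); rewrite -{1}[(q * M)%N]add0n big_addn addKn big_mkord.
(* The last block is a period translated by q M + 1, as summation starts at 1. *)
rewrite -(@sum_complete_residues _ q F (fun n => n + (q * M).+1%:Z))//.
  by apply: eq_bigr => i _; congr F; rewrite -PoszD addnS.
by move=> m n; rewrite opprD addrACA subrr addr0.
Qed.

(** The phase is f(n) / q with f = X^2 + 3 g: the summand 1 in the coefficient
    with index 1, which belongs to n^2, provides X^2. *)
Lemma norm_weyl_sum_rational (R : realType) (d k M : nat) (b : 'I_d -> int) :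
  (2 <= d)%N ->
  let q := (3 ^ k)%N in
  let y : 'rV[R]_d := \row_j ((3 * b j + (j == 1 :> nat)%:Z)%:~R / q%:R) in
  `|weyl_sum y (q * M)| ^+ 2 = (M ^ 2 * q)%:R.
Proof.
move=> d_ge2 q y; pose g : {poly int} := \sum_(j < d) b j *: 'X^(j.+1).
have q_gt0 : (0 < q)%N by rewrite expn_gt0.
have fE (n : nat) : \sum_(j < d) y ord0 j * n%:R ^+ j.+1 =
    ('X^2 + 3 *: g).[n%:Z]%:~R / q%:R :> R.
  have -> : ('X^2 + 3 *: g).[n%:Z] =
      \sum_(j < d) (3 * b j + (j == 1 :> nat)%:Z) * n%:Z ^+ j.+1.
    under eq_bigr do rewrite mulrDl.
    rewrite big_split /= [RHS]addrC hornerD hornerXn hornerZ horner_sum mulr_sumr.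
    congr (_ + _); last first.
      by apply: eq_bigr => j _; rewrite hornerZ hornerXn mulrA.
    rewrite (bigD1 (Ordinal d_ge2)) //= mul1r big1 ?addr0// => j j1.
    have -> : (j == 1 :> nat) = false := negbTE j1.
    by rewrite mul0r.
  rewrite rmorph_sum mulr_suml; apply: eq_bigr => j _.
  by rewrite mxE rmorphM rmorphXn /= mulrAC.
rewrite sqr_normc /weyl_sum; under eq_bigr do rewrite fE.
rewrite (@sum_periodic _ q M
  (fun n => e2pi (('X^2 + 3 *: g).[n]%:~R / q%:R : R))) //.
  have := gauss_sum_3power R k g; set S := \sum_(_ < _) _ => /= SS.
  rewrite rmorphMn mulrnAl mulrnAr SS; rewrite -mulrnA -mulrnA; congr (_ *+ _); lia.
move=> m n mn; apply: e2pi_frac_periodic => //.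
exact: dvdz_trans mn (dvdz_horner_sub _ m n).
Qed.

(** * Density of large sums *)

(** Taking for b_j the integer part of q x_j / 3, the numerators 3 b_j or
    3 b_j + 1 differ from q x_j by less than 3. *)
Lemma rational_approx (R : realType) (d : nat) (x : 'rV[R]_d) (e : R) : 0 < e ->
  exists (k : nat) (b : 'I_d -> int), (0 < k)%N /\
    forall j, `|x ord0 j - (3 * b j + (j == 1 :> nat)%:Z)%:~R / (3 ^ k)%:R| < e.
Proof.
move=> e0; pose k := (Num.truncn (3 / e)).+1; pose q : R := (3 ^ k)%:R.
have q_gt : 3 / e < q.
  apply: lt_trans (truncnS_gt _) _; rewrite ltr_nat.
  exact: ltn_expl.
have q0 : 0 < q by apply: le_lt_trans q_gt; rewrite divr_ge0// ltW.
have qN0 : q != 0 by rewrite gt_eqF.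
have e3 : 3 < e * q by rewrite mulrC -ltr_pdivrMr.
exists k, (fun j => Num.floor (q * x ord0 j / 3)); split=> // j; rewrite -/q.
have /andP[] := floor_itv (q * x ord0 j / 3).
move: (Num.floor _) => b lb ub.
rewrite -(ltr_pM2r q0) -[q in `|_| * q](gtr0_norm q0) -normrM mulrBl divfK//.
rewrite intrD in ub; rewrite intrD intrM ltr_norml.
by case: (j == 1 :> nat) => /=; apply/andP; split; lra.
Qed.

(** With N = q^(r + 1), the inequality compares the exponents 2 alpha (r + 1)
    and 2 r + 1 of q; it holds when r (1 - alpha) > 1. *)
Lemma powR_gap (R : realType) (alpha : R) (q K : nat) :
  alpha < 1 -> (1 < q)%N ->
  exists r : nat, (K <= q * q ^ r)%N /\
    ((q * q ^ r)%:R `^ alpha) ^+ 2 < ((q ^ r) ^ 2 * q)%:R :> R.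
Proof.
move=> alpha1 q1.
pose r := (K + (Num.truncn (1 - alpha)^-1).+1)%N.
have r_gt : (1 - alpha)^-1 < r%:R :> R.
  by apply: lt_le_trans (truncnS_gt _) _; rewrite ler_nat leq_addl.
exists r; split.
  rewrite -expnS; apply: leq_trans (ltnW (ltn_expl _ q1)); lia.
have q1R : 1 < q%:R :> R by rewrite ltr1n.
have q0R : 0 <= q%:R :> R by [].
rewrite -expnS -expnM -expnSr !natrX -!powR_mulrn// -!powRrM.
rewrite /powR gt_eqF ?(lt_trans _ q1R)// ltr_expR ltr_pM2r ?ln_gt0//.
have rgap : 1 < r%:R * (1 - alpha) by rewrite -ltr_pdivrMr ?subr_gt0// mul1r.
rewrite -!natr1 natrM; move: (r%:R : R) rgap => t tgap; nra.
Qed.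

Lemma large_weyl_sum_dense (R : realType) (alpha : R) (d K : nat)
    (x : 'rV[R]_d) (e : R) : alpha < 1 -> (2 <= d)%N -> 0 < e ->
  exists (y : 'rV[R]_d) (N : nat),
    [/\ ball x e y, (K < N)%N & N%:R `^ alpha < complex.Re `|weyl_sum y N|].
Proof.
move=> alpha1 d_ge2 e0; have [k [b [k0 xb]]] := rational_approx x e0.
have q1 : (1 < 3 ^ k)%N by rewrite -{1}(expn0 3) ltn_exp2l.
have [r [Kr gap]] := powR_gap K.+1 alpha1 q1.
set q := (3 ^ k)%N in q1 Kr gap xb.
pose y : 'rV[R]_d := \row_j ((3 * b j + (j == 1 :> nat)%:Z)%:~R / q%:R).
exists y, (q * q ^ r)%N; split=> //.
  by split=> // i j; rewrite ord1 mxE; exact: xb.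
have := norm_weyl_sum_rational R k (q ^ r) b d_ge2; rewrite -/y -/q.
set w := weyl_sum _ _ => wE.
have wr : `|w| = (complex.Re `|w|)%:C%C by rewrite normc_def.
have w0 : 0 <= complex.Re `|w| by rewrite -ler0c -wr.
rewrite -(ltr_pXn2r (n := 2))// ?nnegrE ?powR_ge0//.
suff -> : complex.Re `|w| ^+ 2 = ((q ^ r) ^ 2 * q)%:R by [].
by apply: complexI; rewrite rmorphXn /= -wr wE rmorph_nat.
Qed.

(** * Continuity and the category statement *)

Lemma norm_weyl_sum_continuous (R : realType) (d N : nat) :
  continuous (fun x : 'rV[R]_d => complex.Re `|weyl_sum x N|).
Proof.
have monc n (j : 'I_d) :
    continuous (fun y : 'rV[R]_d => y ord0 j * n%:R ^+ j.+1).
  move=> y; apply: (@continuousM R 'rV[R]_d (fun y => y ord0 j)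
    (fun=> n%:R ^+ j.+1) y).
    exact: coord_continuous.
  exact: cst_continuous.
have scont (f : nat -> R -> R) : (forall n, continuous (f n)) ->
    continuous (fun x : 'rV[R]_d =>
       \sum_(1 <= n < N.+1) f n (\sum_(j < d) x ord0 j * n%:R ^+ j.+1)).
  move=> fc; apply: continuous_big; first exact: add_continuous.
  move=> n _ x; apply: continuous_comp; last exact: fc.
  apply: (@continuous_big _ _ _ _ _ add_continuous _ _
    (fun j (y : 'rV[R]_d) => y ord0 j * n%:R ^+ j.+1)) => j _.
  exact: monc.
have ReE x : complex.Re (weyl_sum x N) = \sum_(1 <= n < N.+1)
    cos (2 * pi * (\sum_(j < d) x ord0 j * n%:R ^+ j.+1)) :> R.
  rewrite /weyl_sum; elim/big_rec2: _ => //= n a b _ <-.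
  by rewrite e2piE; case: b.
have ImE x : complex.Im (weyl_sum x N) = \sum_(1 <= n < N.+1)
    sin (2 * pi * (\sum_(j < d) x ord0 j * n%:R ^+ j.+1)) :> R.
  rewrite /weyl_sum; elim/big_rec2: _ => //= n a b _ <-.
  by rewrite e2piE; case: b.
have lc (g : R -> R) : continuous g -> continuous (fun t : R => g (2 * pi * t)).
  move=> gc t; apply: (@continuous_comp _ _ _ (fun t : R => 2 * pi * t) g).
    exact: mulrl_continuous.
  exact: gc.
have c2 (g : R -> R) : continuous g ->
   continuous (fun x : 'rV[R]_d =>
    (\sum_(1 <= n < N.+1)
      g (2 * pi * (\sum_(j < d) x ord0 j * n%:R ^+ j.+1))) ^+ 2).
  move=> /lc gc; have {}gc := @scont (fun=> _) (fun=> gc) => x.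
  exact: (@continuousM R 'rV[R]_d _ _ x (gc x) (gc x)).
pose A (x : 'rV[R]_d) := \sum_(1 <= n < N.+1)
  cos (2 * pi * (\sum_(j < d) x ord0 j * n%:R ^+ j.+1)) :> R.
pose B (x : 'rV[R]_d) := \sum_(1 <= n < N.+1)
  sin (2 * pi * (\sum_(j < d) x ord0 j * n%:R ^+ j.+1)) :> R.
(* The modulus is rewritten through real and imaginary parts, so that only
   continuity of real functions is used. *)
have -> : (fun x : 'rV[R]_d => complex.Re `|weyl_sum x N|) =
    (fun x => Num.sqrt (A x ^+ 2 + B x ^+ 2)).
  by apply/funext => x; rewrite normc_def ReE ImE.
move=> x; apply: (@continuous_comp _ _ _ (fun x => A x ^+ 2 + B x ^+ 2) Num.sqrt);
  last exact: sqrt_continuous.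
exact: (@continuousD R R^o 'rV[R]_d _ _ x (c2 _ (@continuous_cos R) x)
  (c2 _ (@continuous_sin R) x)).
Qed.

Theorem theorem1p3 (R : realType) (alpha : R) (d : nat)
    (halpha0 : 0 < alpha) (halpha1 : alpha < 1) (hd : (2 <= d)%N) :
  first_category (torus R d `\` large_weyl_set alpha d).
Proof.
exists (fun k => [set x | torus R d x /\ forall N : nat, (k < N)%N ->
  complex.Re `|weyl_sum x N| < N%:R `^ alpha]); split=> [k|].
  rewrite /nowhere_dense -subset0 => x /nbhs_ballP[e /= e0 xe].
  have [y [N [/xe yF kN]]] := large_weyl_sum_dense k x halpha1 hd e0.
  apply/negP; rewrite -leNgt.
  (* D is closed and contains the k-th set, hence also its limit point y. *)
  pose D := (fun x : 'rV[R]_d => complex.Re `|weyl_sum x N|) @^-1`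
    [set t | t <= N%:R `^ alpha].
  have Dclosed : closed D.
    apply: preimage_closed; last exact: closed_le.
    by move=> z _; exact: norm_weyl_sum_continuous.
  apply: (Dclosed y); apply: closure_subset yF => z [_ zF].
  by apply/ltW/zF.
have largeE (x : 'rV[R]_d) N : ((N%:R `^ alpha)%:C%C <= `|weyl_sum x N|)
    = (N%:R `^ alpha <= complex.Re `|weyl_sum x N|).
  by rewrite normc_def lecR.
apply/seteqP; split=> x.
  move=> [xT xE]; have /finite_seqP[s sE] : finite_set [set N : nat | (0 < N)%N /\
      (N%:R `^ alpha)%:C%C <= `|weyl_sum x N|].
    by apply: contrapT => xinf; apply: xE.
  exists (\max_(i <- s) i)%N => //; split=> // N XN.
  rewrite ltNge -largeE; apply/negP => Nlarge.
  have : [set` s] N by rewrite -sE; split=> //; lia.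
  move=> /= Ns.
  by have := @leq_bigmax_seq _ s xpredT id N Ns erefl; rewrite leqNgt XN.
move=> [k _ [xT xF]]; split=> // -[_]; apply.
apply: sub_finite_set (finite_II k.+1) => N [_ /=].
by rewrite largeE ltnS leqNgt; apply: contraTN => /xF; rewrite ltNge.
Qed.
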